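(* Assume that for $\lambda_j=\xi_j+\mathrm{i}\eta_j\in\mathbb{C}$ (with $\xi_j,\eta_j\in\mathbb{R}$), $j=1,\dots,m$, at least one of the sequences $\{\xi_j\}_{j=1}^m$ and $\{\eta_j\}_{j=1}^m$ is not constant, and $\xi_j\le 0$ for $j=1,\dots,m$. Let $\mathrm{avg}(\xi)=\sum_{j=1}^m\xi_j/m$ be the average and $\mathrm{var}(\xi)=\sum_{j=1}^m(\xi_j-\mathrm{avg}(\xi))^2/m$ be the variance of $\{\xi_1,\dots,\xi_m\}$, and $\mathrm{var}(\eta)$ the variance of $\{\eta_1,\dots,\eta_m\}$ (defined in the same way). Then: (a) $$|\exp_t[\lambda_1,\dots,\lambda_m]|=\frac{t^{m-1}}{(m-1)!}\exp\big(\rho_1t+\rho_2t^2/2+\mathcal{O}(t^3)\big)\quad\text{for } t\to0,$$ with $$\rho_1=\mathrm{avg}(\xi),\qquad \rho_2=\frac{\mathrm{var}(\xi)-\mathrm{var}(\eta)}{m+1},$$ and either $\rho_1\ne0$ or $\rho_2\neq0$. (b) The derivative of the effective order $\rho(t)=\dfrac{f'(t)\,t}{f(t)}$ of $f(t)=|\exp_t[\lambda_1,\dots,\lambda_m]|$ satisfies $$\rho'(t)=\rho_1+\rho_2t+\mathcal{O}(t^2)\quad\text{for } t\to0,$$ and $$\rho'(0+)<0.$$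
   Context: For $t\in\mathbb{R}$, $\exp_t$ denotes the function $\lambda\mapsto e^{t\lambda}$, and $\exp_t[\lambda_1,\dots,\lambda_m]$ is its divided difference over the nodes $\lambda_1,\dots,\lambda_m$ (in the confluent sense for repeated nodes). The function $f(t)=|\exp_t[\lambda_1,\dots,\lambda_m]|$ is positive for all sufficiently small $t>0$, so the effective order $\rho(t)$ is well defined there; $f'$ and $\rho'$ denote derivatives with respect to $t$. The asymptotics are for $t>0$ tending to $0$, and the argument $0+$ denotes the limit as $t\to0$ from the right.
   Formalization: In (b) the expansion is corrected to ρ'(t)=ρ1+2ρ2 t+O(t²); since ρ'(0+)=ρ1 is 0 when all ξ_j=0 (e.g. λ=±i), ρ'(0+)<0 is replaced by: ρ'(t)<0 for all small t>0, ρ'(0+)≤0, and ρ'(0+)<0 if some ξ_j≠0. *)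

(* Defs.v *)
From Stdlib Require Import Reals List Factorial.
From Coquelicot Require Import Coquelicot.
Import ListNotations.
Open Scope R_scope.

Definition Cexp (z : C) : C := (exp (Re z) * cos (Im z), exp (Re z) * sin (Im z)).

Definition exp_t (t : R) : C -> C := fun z => Cexp (RtoC t * z)%C.

Fixpoint C_derive_n (f : C -> C) (n : nat) : C -> C :=
  match n with
  | O => f
  | S k => C_derive (C_derive_n f k)
  end.

(* Splits off the first entry of [s] that differs from [x], returning it
   together with the remaining entries. *)
Fixpoint extract_neq (x : C) (s : list C) : option (C * list C) :=
  match s with
  | [] => None
  | y :: s' =>
      if Ceq_dec y x then
        match extract_neq x s' with
        | None => None
        | Some (z, r) => Some (z, y :: r)
        end
      else Some (y, s')
  end.

(* Confluent divided difference over the [n + 1] nodes [x :: s], where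
   [n = length s].  If all nodes coincide, it is f^(n)(x) / n!.  Otherwise the
   recurrence
     f[x, y, r] = (f[y, r] - f[x, r]) / (y - x)
   is applied to the first node [y <> x]; as divided differences are symmetric
   in their nodes, equal nodes need not be adjacent in the list. *)
Fixpoint divdiff_rec (f : C -> C) (n : nat) (x : C) (s : list C) : C :=
  match n with
  | O => f x
  | S k =>
      match extract_neq x s with
      | None => (C_derive_n f n x / RtoC (INR (fact n)))%C
      | Some (y, r) =>
          ((divdiff_rec f k y r - divdiff_rec f k x r) / (y - x))%C
      end
  end.

(* The value on the empty list is irrelevant. *)
Definition divdiff (f : C -> C) (nodes : list C) : C :=
  match nodes with
  | [] => RtoC 0
  | x :: s => divdiff_rec f (length s) x s
  end.

(* Sequences are indexed by 1, ..., m; other indices are ignored. *)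
Definition nodes (m : nat) (xi eta : nat -> R) : list C :=
  map (fun j => (xi j, eta j) : C) (seq 1 m).

Definition constant_seq (m : nat) (a : nat -> R) : Prop :=
  forall i j : nat, (1 <= i <= m)%nat -> (1 <= j <= m)%nat -> a i = a j.

Definition seq_avg (m : nat) (a : nat -> R) : R := sum_n_m a 1 m / INR m.

Definition seq_var (m : nat) (a : nat -> R) : R :=
  sum_n_m (fun j => (a j - seq_avg m a) ^ 2) 1 m / INR m.

Definition effective_order (f : R -> R) (t : R) : R := Derive f t * t / f t.

(* g(t) = O(t^k) as t tends to 0 from the right. *)
Definition bigO_right0 (k : nat) (g : R -> R) : Prop :=
  exists M : R, at_right 0 (fun t => Rabs (g t) <= M * t ^ k).

(* Main.v *)
Require Import Defs.
From Stdlib Require Import Reals List Factorial Permutation Classical_Prop Lra Lia.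
From Coquelicot Require Import Coquelicot.
Import ListNotations.
Open Scope R_scope.

(* With n + 1 nodes, exp_t[lambda] is the sum over j of
   t^(j+n) h_j(lambda) / (j+n)!, where h_j is the complete homogeneous symmetric
   polynomial: both sides satisfy the recurrence of divided differences.  Hence
   |exp_t[lambda]| = t^n exp(L(t)) with L = ln(P^2 + Q^2) / 2 smooth near 0, where
   P and Q are the real and imaginary parts of the series without the factor t^n.
   L'(0) and L''(0) are computed from h_1 and h_2, Taylor's bound on L gives (a),
   and (b) follows from rho(t) = n + t L'(t).  Finally, if avg(xi) = 0 then all
   xi_j vanish, so that rho_2 = - var(eta) / (m + 1) < 0. *)

Lemma C_eq (z w : C) : fst z = fst w -> snd z = snd w -> z = w.
Proof. destruct z, w; simpl; intros -> ->; reflexivity. Qed.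

(** * Complete homogeneous symmetric polynomials *)

(* [geom_conv x a] is the coefficient sequence of A(T) / (1 - x T), where A is
   the generating function of [a]. *)
Fixpoint geom_conv (x : C) (a : nat -> C) (k : nat) : C :=
  match k with
  | O => a O
  | S j => (x * geom_conv x a j + a (S j))%C
  end.

(** The generating function of [hsym l] is the product of 1 / (1 - x T) over the entries x of
    [l]. *)
Fixpoint hsym (l : list C) : nat -> C :=
  match l with
  | [] => fun k => match k with O => RtoC 1 | S _ => RtoC 0 end
  | x :: s => geom_conv x (hsym s)
  end.

Lemma geom_conv_ext (x : C) (a b : nat -> C) :
  (forall k, a k = b k) -> forall k, geom_conv x a k = geom_conv x b k.
Proof.
  intros H k; induction k as [|k IH]; simpl; rewrite H; [|rewrite IH]; reflexivity.
Qed.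

(** Partial fractions: (y - x) T / ((1 - x T)(1 - y T)) = 1 / (1 - y T) - 1 / (1 - x T), multiplied
    by the generating function of [a] and read at T^(k+1). *)
Lemma geom_conv_sub (x y : C) (a : nat -> C) (k : nat) :
  ((y - x) * geom_conv x (geom_conv y a) k
   = geom_conv y a (S k) - geom_conv x a (S k))%C.
Proof.
  induction k as [|k IH].
  - simpl; ring.
  - change (geom_conv x (geom_conv y a) (S k))
      with (x * geom_conv x (geom_conv y a) k + geom_conv y a (S k))%C.
    change (geom_conv y a (S (S k))) with (y * geom_conv y a (S k) + a (S (S k)))%C.
    change (geom_conv x a (S (S k))) with (x * geom_conv x a (S k) + a (S (S k)))%C.
    transitivity (x * ((y - x) * geom_conv x (geom_conv y a) k)
                  + (y - x) * geom_conv y a (S k))%C; [ring|].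
    rewrite IH; ring.
Qed.

Lemma Cminus_neq0 (x y : C) : y <> x -> (y - x)%C <> RtoC 0.
Proof.
  intros H E; apply H.
  transitivity ((y - x) + x)%C; [ring|rewrite E; ring].
Qed.

(** For distinct x and y, the right side of [geom_conv_sub] changes sign when they are exchanged,
    and so does the factor y - x. *)
Lemma geom_conv_comm (x y : C) (a : nat -> C) (k : nat) :
  geom_conv x (geom_conv y a) k = geom_conv y (geom_conv x a) k.
Proof.
  destruct (Ceq_dec y x) as [->|Hne]; [reflexivity|].
  pose proof (geom_conv_sub x y a k) as H1.
  pose proof (geom_conv_sub y x a k) as H2.
  apply Cminus_neq0 in Hne.
  transitivity (((y - x) * geom_conv x (geom_conv y a) k) / (y - x))%C; [field; auto|].
  rewrite H1.
  transitivity (((y - x) * geom_conv y (geom_conv x a) k) / (y - x))%C; [|field; auto].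
  f_equal.
  transitivity (- ((x - y) * geom_conv y (geom_conv x a) k))%C; [rewrite H2|]; ring.
Qed.

(** Needed because [extract_neq] may take a node out of the middle of the list. *)
Lemma hsym_Permutation (l l' : list C) :
  Permutation l l' -> forall k, hsym l k = hsym l' k.
Proof.
  induction 1 as [|x l l' _ IH|x y l|l l' l'' _ IH1 _ IH2]; intros k.
  - reflexivity.
  - apply geom_conv_ext, IH.
  - apply geom_conv_comm.
  - rewrite IH1; apply IH2.
Qed.

Lemma hsym_cons_sub (x y : C) (s : list C) (k : nat) :
  ((y - x) * hsym (x :: y :: s) k = hsym (y :: s) (S k) - hsym (x :: s) (S k))%C.
Proof. apply geom_conv_sub. Qed.

Lemma hsym_cons_S (x : C) (s : list C) (k : nat) :
  hsym (x :: s) (S k) = (x * hsym (x :: s) k + hsym s (S k))%C.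
Proof. reflexivity. Qed.

Lemma hsym_0 (l : list C) : hsym l 0 = RtoC 1.
Proof. induction l as [|x l IH]; [reflexivity|exact IH]. Qed.

(** For n + 1 equal nodes, h_j is binomial(j + n, n) x^j, written here without division. The double
    induction is Pascal's rule, in the form of [hsym_cons_S]. *)
Lemma hsym_repeat (x : C) (n j : nat) :
  (hsym (repeat x (S n)) j * RtoC (INR (fact j) * INR (fact n))
   = RtoC (INR (fact (j + n))) * x ^ j)%C.
Proof.
  revert j; induction n as [|n IHn]; intros j.
  - rewrite Nat.add_0_r; change (INR (fact 0)) with 1; rewrite Rmult_1_r, Cmult_comm.
    f_equal.
    induction j as [|j IHj]; [reflexivity|].
    change (hsym (repeat x 1) (S j)) with (x * hsym (repeat x 1) j + RtoC 0)%C.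
    rewrite IHj; simpl; ring.
  - induction j as [|j IHj].
    + rewrite hsym_0; simpl Nat.add; simpl Cpow; change (INR (fact 0)) with 1.
      rewrite Rmult_1_l; ring.
    + change (repeat x (S (S n))) with (x :: repeat x (S n)) in *.
      rewrite hsym_cons_S.
      specialize (IHn (S j)).
      replace (S j + S n)%nat with (S (S j + n)) by lia.
      replace (j + S n)%nat with (S j + n)%nat in IHj by lia.
      rewrite (fact_simpl (S j + n)), mult_INR.
      (* The weight (j+1)! (n+1)! releases a factor j + 1 in the first summand and n + 1 in the
         second, to match the two induction hypotheses; these factors add up to the j + n + 2 split
         off from the factorial on the right. *)
      transitivity (x * RtoC (INR (S j)) * (hsym (x :: repeat x (S n)) j *
          RtoC (INR (fact j) * INR (fact (S n)))) +
          RtoC (INR (S n)) * (hsym (repeat x (S n)) (S j) *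
          RtoC (INR (fact (S j)) * INR (fact n))))%C.
      { rewrite (fact_simpl j), (fact_simpl n), !mult_INR, !RtoC_mult; ring. }
      rewrite IHj, IHn.
      replace (INR (S (S j + n))) with (INR (S j) + INR (S n))
        by (rewrite <- plus_INR; f_equal; lia).
      rewrite !RtoC_mult, RtoC_plus; simpl Cpow; ring.
Qed.

Definition Csum (l : list C) : C := fold_right Cplus (RtoC 0) l.

Lemma hsym_1 (l : list C) : hsym l 1 = Csum l.
Proof.
  induction l as [|x l IH]; [reflexivity|].
  rewrite hsym_cons_S, hsym_0, IH; simpl; ring.
Qed.

(** Newton's identity 2 h_2 = p_1^2 + p_2. Power sums are what averages and variances are made
    of. *)
Lemma hsym_2 (l : list C) :
  (RtoC 2 * hsym l 2 = Csum l * Csum l + Csum (map (fun x => x * x) l))%C.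
Proof.
  induction l as [|x l IH]; [simpl; ring|].
  rewrite hsym_cons_S, hsym_1.
  transitivity (RtoC 2 * x * Csum (x :: l) + RtoC 2 * hsym l 2)%C; [ring|].
  rewrite IH; simpl; ring.
Qed.

(** * Complex series *)

Definition is_Cseries (a : nat -> C) (l : C) : Prop :=
  is_series (fun j => fst (a j)) (fst l) /\ is_series (fun j => snd (a j)) (snd l).

Lemma is_Cseries_ext (a b : nat -> C) (l : C) :
  (forall j, a j = b j) -> is_Cseries a l -> is_Cseries b l.
Proof.
  intros E [H1 H2]; split;
    [apply is_series_ext with (2 := H1)|apply is_series_ext with (2 := H2)];
    intros j; rewrite E; reflexivity.
Qed.

Lemma is_Cseries_minus (a b : nat -> C) (la lb : C) :
  is_Cseries a la -> is_Cseries b lb ->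
  is_Cseries (fun j => a j - b j)%C (la - lb)%C.
Proof.
  intros [A1 A2] [B1 B2]; split; simpl.
  - apply (is_series_minus _ _ _ _ A1 B1).
  - apply (is_series_minus _ _ _ _ A2 B2).
Qed.

Lemma is_Cseries_scal (c : C) (a : nat -> C) (l : C) :
  is_Cseries a l -> is_Cseries (fun j => c * a j)%C (c * l)%C.
Proof.
  intros [A1 A2]; split; simpl.
  - apply (is_series_minus _ _ _ _ (is_series_scal (fst c) _ _ A1)
             (is_series_scal (snd c) _ _ A2)).
  - apply (is_series_plus _ _ _ _ (is_series_scal (fst c) _ _ A2)
             (is_series_scal (snd c) _ _ A1)).
Qed.

(** Used where two divided differences are subtracted and their leading terms cancel. *)
Lemma is_Cseries_shift (a : nat -> C) (l : C) :
  a O = RtoC 0 -> is_Cseries a l -> is_Cseries (fun j => a (S j)) l.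
Proof.
  intros H [A1 A2]; split.
  - apply (is_series_incr_1 (fun j => fst (a j))); rewrite H; simpl.
    unfold plus; simpl; rewrite Rplus_0_r; exact A1.
  - apply (is_series_incr_1 (fun j => snd (a j))); rewrite H; simpl.
    unfold plus; simpl; rewrite Rplus_0_r; exact A2.
Qed.

(** With a finite radius r, the terms at r + 1 could not tend to 0. *)
Lemma CV_radius_infinite (a : nat -> R) :
  (forall t, 0 < t -> ex_series (fun n => a n * t ^ n)) -> CV_radius a = p_infty.
Proof.
  intros H.
  pose proof (CV_radius_ge_0 a) as Hge.
  destruct (CV_radius a) as [r| |] eqn:E; simpl in Hge; [|reflexivity|tauto].
  exfalso; apply (CV_disk_outside a (r + 1)).
  - rewrite E, Rabs_pos_eq by lra; simpl; lra.
  - apply ex_series_lim_0, H; lra.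
Qed.

(** * The complex exponential *)

(** Uniqueness for z' = (xi + i eta) z with z(0) = 1, where z = P + i Q. It serves to identify the
    sum of the exponential series with [Cexp]. *)
Lemma linear_system_unique (xi eta : R) (P Q : R -> R) :
  (forall t, is_derive P t (xi * P t - eta * Q t)) ->
  (forall t, is_derive Q t (xi * Q t + eta * P t)) ->
  P 0 = 1 -> Q 0 = 0 ->
  forall t, P t = exp (t * xi) * cos (t * eta) /\ Q t = exp (t * xi) * sin (t * eta).
Proof.
  intros HP HQ P0 Q0 t.
  (* U + i V is exp(-t (xi + i eta)) (P + i Q), whose derivative vanishes. *)
  set (U := fun t => exp (- (t * xi)) * (P t * cos (t * eta) + Q t * sin (t * eta))).
  set (V := fun t => exp (- (t * xi)) * (Q t * cos (t * eta) - P t * sin (t * eta))).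
  assert (const : forall (W : R -> R), (forall s, is_derive W s 0) -> W t = W 0).
  { intros W HW.
    destruct (Rtotal_order t 0) as [Ht|[->|Ht]].
    - apply (eq_is_derive W t 0); auto; intros s _; apply HW.
    - reflexivity.
    - symmetry; apply (eq_is_derive W 0 t); auto; intros s _; apply HW. }
  assert (HU : U t = 1).
  { rewrite const.
    - unfold U; rewrite P0, Q0, !Rmult_0_l, Ropp_0, exp_0, cos_0; ring.
    - intros s; unfold U; auto_derive.
      + repeat split; [exists (xi * P s - eta * Q s)|exists (xi * Q s + eta * P s)]; auto.
      + change (fun x => P x) with P; change (fun x => Q x) with Q.
        rewrite (is_derive_unique _ _ _ (HP s)), (is_derive_unique _ _ _ (HQ s)); ring. }
  assert (HV : V t = 0).
  { rewrite const.
    - unfold V; rewrite P0, Q0, !Rmult_0_l, Ropp_0, exp_0, sin_0; ring.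
    - intros s; unfold V; auto_derive.
      + repeat split; [exists (xi * Q s + eta * P s)|exists (xi * P s - eta * Q s)]; auto.
      + change (fun x => P x) with P; change (fun x => Q x) with Q.
        rewrite (is_derive_unique _ _ _ (HP s)), (is_derive_unique _ _ _ (HQ s)); ring. }
  assert (E : exp (t * xi) * exp (- (t * xi)) = 1)
    by (rewrite <- exp_plus, Rplus_opp_r; apply exp_0).
  pose proof (sin2_cos2 (t * eta)) as T; unfold Rsqr in T.
  unfold U in HU; unfold V in HV.
  set (e := exp (t * xi)) in *; set (e' := exp (- (t * xi))) in *.
  set (c := cos (t * eta)) in *; set (s := sin (t * eta)) in *.
  split.
  - transitivity (e * (e' * (P t * c + Q t * s) * c - e' * (Q t * c - P t * s) * s));
      [|rewrite HU, HV; ring].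
    transitivity ((e * e') * P t * (s * s + c * c)); [rewrite E, T; ring|ring].
  - transitivity (e * (e' * (P t * c + Q t * s) * s + e' * (Q t * c - P t * s) * c));
      [|rewrite HU, HV; ring].
    transitivity ((e * e') * Q t * (s * s + c * c)); [rewrite E, T; ring|ring].
Qed.

Lemma Rabs_fst_le_Cmod (z : C) : Rabs (fst z) <= Cmod z.
Proof. apply Rle_trans with (2 := Rmax_Cmod z), Rmax_l. Qed.

Lemma Rabs_snd_le_Cmod (z : C) : Rabs (snd z) <= Cmod z.
Proof. apply Rle_trans with (2 := Rmax_Cmod z), Rmax_r. Qed.

Lemma ex_series_exp_bound (a : nat -> R) (r : R) :
  (forall n, Rabs (a n) <= r ^ n) ->
  forall t, ex_series (fun n => a n / INR (fact n) * t ^ n).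
Proof.
  intros H t.
  apply (@ex_series_le R_AbsRing R_CompleteNormedModule) with (b := fun n => / INR (fact n) * (r * Rabs t) ^ n).
  - intros n.
    change (Rabs (a n / INR (fact n) * t ^ n) <= / INR (fact n) * (r * Rabs t) ^ n).
    unfold Rdiv; rewrite !Rabs_mult, <- RPow_abs, Rpow_mult_distr.
    assert (Hf : 0 < / INR (fact n)) by apply Rinv_0_lt_compat, INR_fact_lt_0.
    rewrite (Rabs_pos_eq (/ _)) by lra.
    apply Rle_trans with (r ^ n * / INR (fact n) * Rabs t ^ n); [|right; ring].
    apply Rmult_le_compat_r; [apply pow_le, Rabs_pos|].
    apply Rmult_le_compat_r; [lra|apply H].
  - exists (exp (r * Rabs t)); apply is_pseries_R, is_exp_Reals.
Qed.

(** The real and imaginary parts of the series are power series in t. Termwise differentiation shows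
    that they solve the system of [linear_system_unique]. *)
Lemma is_Cseries_exp (t : R) (x : C) :
  is_Cseries (fun j => RtoC (t ^ j / INR (fact j)) * x ^ j)%C (exp_t t x).
Proof.
  set (a := fun j => fst (x ^ j)%C / INR (fact j)).
  set (b := fun j => snd (x ^ j)%C / INR (fact j)).
  assert (Ha : forall s, ex_series (fun n => a n * s ^ n)).
  { apply ex_series_exp_bound with (r := Cmod x); intros n.
    rewrite <- Cmod_pow; apply Rabs_fst_le_Cmod. }
  assert (Hb : forall s, ex_series (fun n => b n * s ^ n)).
  { apply ex_series_exp_bound with (r := Cmod x); intros n.
    rewrite <- Cmod_pow; apply Rabs_snd_le_Cmod. }
  assert (Ra := CV_radius_infinite _ (fun s _ => Ha s)); assert (Rb := CV_radius_infinite _ (fun s _ => Hb s)).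
  assert (ea : forall s, ex_pseries a s)
    by (intros s; apply CV_radius_inside; rewrite Ra; exact I).
  assert (eb : forall s, ex_pseries b s)
    by (intros s; apply CV_radius_inside; rewrite Rb; exact I).
  destruct (linear_system_unique (fst x) (snd x) (PSeries a) (PSeries b)) with (t := t)
    as [HP HQ].
  - intros s.
    replace (fst x * PSeries a s - snd x * PSeries b s) with (PSeries (PS_derive a) s).
    { apply is_derive_PSeries; rewrite Ra; exact I. }
    rewrite <- !PSeries_scal, <- PSeries_minus
      by (apply ex_pseries_scal; auto; apply Rmult_comm).
    apply PSeries_ext; intros n; unfold PS_derive, PS_minus, PS_plus, PS_opp, PS_scal, a, b.
    rewrite fact_simpl, mult_INR; simpl Cpow.
    unfold plus, opp, scal; simpl fst; simpl; unfold mult; simpl.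
    field; split; [apply INR_fact_neq_0|]. apply (not_0_INR (S n)); lia.
  - intros s.
    replace (fst x * PSeries b s + snd x * PSeries a s) with (PSeries (PS_derive b) s).
    { apply is_derive_PSeries; rewrite Rb; exact I. }
    rewrite <- !PSeries_scal, <- PSeries_plus
      by (apply ex_pseries_scal; auto; apply Rmult_comm).
    apply PSeries_ext; intros n; unfold PS_derive, PS_plus, PS_scal, a, b.
    rewrite fact_simpl, mult_INR; simpl Cpow.
    unfold plus, scal; simpl fst; simpl; unfold mult; simpl.
    field; split; [apply INR_fact_neq_0|]. apply (not_0_INR (S n)); lia.
  - rewrite PSeries_0; unfold a; simpl; field.
  - rewrite PSeries_0; unfold b; simpl; field.
  - unfold exp_t, Cexp, Re, Im; split; simpl fst; simpl snd.
    + replace (t * fst x - 0 * snd x) with (t * fst x) by ring.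
      replace (t * snd x + 0 * fst x) with (t * snd x) by ring.
      rewrite <- HP; eapply is_series_ext; [|apply Series_correct, (Ha t)].
      intros n; unfold a; simpl; unfold Rdiv; ring.
    + replace (t * fst x - 0 * snd x) with (t * fst x) by ring.
      replace (t * snd x + 0 * fst x) with (t * snd x) by ring.
      rewrite <- HQ; eapply is_series_ext; [|apply Series_correct, (Hb t)].
      intros n; unfold b; simpl; unfold Rdiv; ring.
Qed.

(** [C_lim], and with it [C_derive], takes limits along the horizontal line through z, so
    derivatives in the real direction determine it. *)
Lemma C_derive_eq (f : C -> C) (z l : C) :
  is_derive (fun x => fst (f (x, snd z))) (fst z) (fst l) ->
  is_derive (fun x => snd (f (x, snd z))) (fst z) (snd l) ->
  C_derive f z = l.
Proof.
  assert (key : forall (g : R -> R) (x0 d : R), is_derive g x0 d ->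
            is_lim (fun x => (g x - g x0) / (x - x0)) x0 d).
  { intros g x0 d H; apply is_derive_Reals in H.
    apply is_lim_spec; intros eps.
    destruct (H eps (cond_pos eps)) as [del Hdel].
    exists del; intros x Hx Hne; change R in x.
    specialize (Hdel (x - x0)).
    replace (x0 + (x - x0)) with x in Hdel by ring.
    apply Hdel; [lra|exact Hx]. }
  intros H1 H2; unfold C_derive, C_lim; apply C_eq; simpl.
  - rewrite (is_lim_unique _ _ (Finite (fst l))); [reflexivity|].
    eapply is_lim_ext_loc; [|apply (key _ _ _ H1)].
    exists posreal_one; intros x _ Hne; destruct z as [u v]; simpl in *; field.
    assert (x - u <> 0) by lra; split; nra.
  - rewrite (is_lim_unique _ _ (Finite (snd l))); [reflexivity|].
    eapply is_lim_ext_loc; [|apply (key _ _ _ H2)].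
    exists posreal_one; intros x _ Hne; destruct z as [u v]; simpl in *; field.
    assert (x - u <> 0) by lra; split; nra.
Qed.

Lemma C_derive_n_exp (t : R) (n : nat) (z : C) :
  C_derive_n (exp_t t) n z = (RtoC (t ^ n) * exp_t t z)%C.
Proof.
  revert z; induction n as [|n IH]; intros z; simpl C_derive_n; [simpl; ring|].
  apply C_derive_eq.
  - apply is_derive_ext with
      (f := fun x => t ^ n * (exp (t * x) * cos (t * snd z))).
    + intros x; rewrite IH; simpl; rewrite !Rmult_0_l, !Rminus_0_r, !Rplus_0_r.
      ring.
    + destruct z as [u v]; simpl; rewrite !Rmult_0_l, !Rminus_0_r, !Rplus_0_r.
      auto_derive; [exact I|ring].
  - apply is_derive_ext with
      (f := fun x => t ^ n * (exp (t * x) * sin (t * snd z))).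
    + intros x; rewrite IH; simpl; rewrite !Rmult_0_l, !Rminus_0_r, !Rplus_0_r.
      ring.
    + destruct z as [u v]; simpl; rewrite !Rmult_0_l, !Rminus_0_r, !Rplus_0_r.
      auto_derive; [exact I|ring].
Qed.

(** * Divided differences of the exponential *)

Lemma extract_neq_None (x : C) (s : list C) :
  extract_neq x s = None -> s = repeat x (length s).
Proof.
  induction s as [|y s IH]; simpl; [reflexivity|].
  destruct (Ceq_dec y x) as [->|]; [|discriminate].
  destruct (extract_neq x s) as [[z r]|]; [discriminate|].
  intros _; rewrite <- IH by reflexivity; reflexivity.
Qed.

Lemma extract_neq_Some (x y : C) (s r : list C) :
  extract_neq x s = Some (y, r) -> y <> x /\ Permutation s (y :: r).
Proof.
  revert r; induction s as [|w s IH]; simpl; intros r; [discriminate|].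
  destruct (Ceq_dec w x) as [->|Hne].
  - destruct (extract_neq x s) as [[z r']|]; [|discriminate].
    injection 1 as -> <-.
    destruct (IH r' eq_refl) as [H1 H2]; split; [exact H1|].
    rewrite H2; apply perm_swap.
  - injection 1 as <- <-; split; [exact Hne|reflexivity].
Qed.

(** Induction along the recurrence of [divdiff_rec]: [hsym_cons_sub] says that the coefficients h_j
    obey the same recurrence with the degree shifted by one. *)
Lemma divdiff_exp_series (t : R) (n : nat) (x : C) (s : list C) :
  length s = n ->
  is_Cseries (fun j => RtoC (t ^ (j + n) / INR (fact (j + n))) * hsym (x :: s) j)%C
    (divdiff_rec (exp_t t) n x s).
Proof.
  (* All nodes equal: by [hsym_repeat], term j is t^n / n! times the term t^j x^j / j! of the
     exponential series. *)
  assert (const : forall n x, is_Cseries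
     (fun j => RtoC (t ^ (j + n) / INR (fact (j + n))) * hsym (repeat x (S n)) j)%C
     (RtoC (t ^ n / INR (fact n)) * exp_t t x)%C).
  { clear; intros n x.
    eapply is_Cseries_ext; [|apply is_Cseries_scal, is_Cseries_exp].
    intros j; simpl.
    assert (N : forall k, INR (fact k) <> 0) by apply INR_fact_neq_0.
    assert (N' : forall k, RtoC (INR (fact k)) <> RtoC 0)
      by (intros k H; apply (N k); injection H; auto).
    transitivity (RtoC (t ^ (j + n) / INR (fact j) / INR (fact n) / INR (fact (j + n)))
                  * (RtoC (INR (fact (j + n))) * x ^ j))%C.
    - rewrite Rdef_pow_add, !RtoC_div, !RtoC_mult by auto; field; auto.
    - rewrite <- hsym_repeat, !RtoC_div, RtoC_mult by auto; simpl hsym; field; auto. }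
  revert x s; induction n as [|k IH]; intros x s Hs.
  - destruct s; [|discriminate]; simpl divdiff_rec.
    replace (exp_t t x) with (RtoC (t ^ 0 / INR (fact 0)) * exp_t t x)%C
      by (simpl; rewrite Rdiv_1_r; ring).
    apply (const 0%nat x).
  - simpl divdiff_rec.
    destruct (extract_neq x s) as [[y r]|] eqn:E.
    + apply extract_neq_Some in E; destruct E as [Hne Hperm].
      assert (Hr : length r = k).
      { apply Permutation_length in Hperm; simpl in Hperm; lia. }
      apply Cminus_neq0 in Hne.
      pose proof (is_Cseries_minus _ _ _ _ (IH y r Hr) (IH x r Hr)) as H.
      (* Both series start with t^k / k!, since h_0 = 1, so the difference starts at degree k + 1 in
         t. *)
      apply is_Cseries_shift in H; [|rewrite !hsym_0; ring].
      apply (is_Cseries_scal (/ (y - x))%C) in H.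
      replace ((divdiff_rec (exp_t t) k y r - divdiff_rec (exp_t t) k x r) / (y - x))%C
        with (/ (y - x) *
              (divdiff_rec (exp_t t) k y r - divdiff_rec (exp_t t) k x r))%C
        by (unfold Cdiv; ring).
      eapply is_Cseries_ext; [|exact H].
      intros j; cbv beta.
      (* Bring y next to x, as [hsym_cons_sub] expects. *)
      rewrite (hsym_Permutation _ _ (perm_skip x Hperm)).
      replace (S j + k)%nat with (j + S k)%nat by lia.
      transitivity (/ (y - x) * (RtoC (t ^ (j + S k) / INR (fact (j + S k))) *
          (hsym (y :: r) (S j) - hsym (x :: r) (S j))))%C; [ring|].
      rewrite <- hsym_cons_sub; field; auto.
    + apply extract_neq_None in E; rewrite Hs in E.
      change (fact k + k * fact k)%nat with (fact (S k)).
      change (C_derive (C_derive_n (exp_t t) k) x)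
        with (C_derive_n (exp_t t) (S k) x).
      rewrite C_derive_n_exp, E.
      replace (RtoC (t ^ S k) * exp_t t x / RtoC (INR (fact (S k))))%C
        with (RtoC (t ^ S k / INR (fact (S k))) * exp_t t x)%C.
      * apply (const (S k) x).
      * rewrite RtoC_div by apply INR_fact_neq_0; unfold Cdiv; ring.
Qed.

(** * Expansion of the effective order *)

Lemma at_right_0 (d : R) (A : R -> Prop) :
  0 < d -> (forall t, 0 < t < d -> A t) -> at_right 0 A.
Proof.
  intros Hd H; exists (mkposreal d Hd); intros t Ht Hpos.
  change (Rabs (t - 0) < d) in Ht.
  rewrite Rminus_0_r, Rabs_pos_eq in Ht by lra; apply H; lra.
Qed.

Lemma continuous_neighborhood_0 (g : R -> R) (e : R) :
  continuous g 0 -> 0 < e ->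
  exists d, 0 < d /\ forall t, Rabs t < d -> Rabs (g t - g 0) < e.
Proof.
  intros Hc He; destruct (Hc _ (locally_ball (g 0) (mkposreal e He))) as [d Hd].
  exists d; split; [apply cond_pos|]; intros t Ht; apply Hd.
  change (Rabs (t - 0) < d); rewrite Rminus_0_r; exact Ht.
Qed.

(** Mean value theorem. Keeping M instead of M / (k + 1) lets the bound be iterated with one
    constant. *)
Lemma antiderivative_bound (g g' : R -> R) (d M : R) (k : nat) :
  (forall s, 0 <= s < d -> is_derive g s (g' s)) ->
  g 0 = 0 ->
  (forall s, 0 <= s < d -> Rabs (g' s) <= M * s ^ k) ->
  0 <= M ->
  forall s, 0 <= s < d -> Rabs (g s) <= M * s ^ S k.
Proof.
  intros Hg g0 Hb HM s Hs.
  destruct (MVT_gen g 0 s g') as [c [Hc E]].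
  - rewrite Rmin_left, Rmax_right by lra; intros x Hx; apply Hg; lra.
  - rewrite Rmin_left, Rmax_right by lra; intros x Hx.
    apply continuity_pt_filterlim, (ex_derive_continuous g); exists (g' x); apply Hg; lra.
  - rewrite Rmin_left, Rmax_right in Hc by lra.
    replace (g s) with (g' c * (s - 0)) by lra.
    rewrite Rabs_mult, (Rabs_pos_eq (s - 0)), Rminus_0_r by lra.
    apply Rle_trans with (M * s ^ k * s); [|right; simpl; ring].
    apply Rmult_le_compat_r; [lra|].
    apply Rle_trans with (M * c ^ k); [apply Hb; lra|].
    apply Rmult_le_compat_l; [lra|apply pow_incr; lra].
Qed.

(** The derivatives are named functions so that their values at 0 can be computed; the bound on the
    third one yields a remainder of order t^3. *)
Definition log_jet (L L1 L2 L3 : R -> R) (d M : R) : Prop :=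
  0 < d /\ 0 <= M /\
  forall t, Rabs t < d ->
    is_derive L t (L1 t) /\ is_derive L1 t (L2 t) /\ is_derive L2 t (L3 t) /\
    Rabs (L3 t) <= M.

(** To be used with u0 a squared modulus, so that exp(ln u0 / 2) is the modulus. The third
    derivative of ln u0 / 2 is continuous at 0, hence bounded nearby, because u0 is positive
    there. *)
Lemma log_jet_of_jet (u0 u1 u2 u3 : R -> R) :
  (forall t, is_derive u0 t (u1 t)) ->
  (forall t, is_derive u1 t (u2 t)) ->
  (forall t, is_derive u2 t (u3 t)) ->
  continuous u3 0 -> 0 < u0 0 ->
  exists L3 d M,
    log_jet (fun t => ln (u0 t) / 2) (fun t => u1 t / (2 * u0 t))
      (fun t => (u2 t * u0 t - u1 t ^ 2) / (2 * u0 t ^ 2)) L3 d M /\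
    forall t, Rabs t < d -> 0 < u0 t.
Proof.
  intros H0 H1 H2 C3 Hpos.
  (* The quotient rule applied to the second derivative; the product with an inverse suits the
     continuity proof below. *)
  set (L3 := fun t => ((u3 t * u0 t - u1 t * u2 t) * u0 t
                       - 2 * (u2 t * u0 t - u1 t ^ 2) * u1 t) * / (2 * u0 t ^ 3)).
  assert (C0 : continuous u0 0) by (apply (ex_derive_continuous u0); eexists; apply H0).
  assert (C1 : continuous u1 0) by (apply (ex_derive_continuous u1); eexists; apply H1).
  assert (C2 : continuous u2 0) by (apply (ex_derive_continuous u2); eexists; apply H2).
  assert (CL : continuous L3 0).
  { assert (Cm : forall f g : R -> R, continuous f 0 -> continuous g 0 ->
              continuous (fun t => f t * g t) 0)
      by (intros f g; apply (continuous_mult (K := R_AbsRing) f g)).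
    assert (Cs : forall f g : R -> R, continuous f 0 -> continuous g 0 ->
              continuous (fun t => f t - g t) 0)
      by (intros f g; apply (continuous_minus (V := R_NormedModule) f g)).
    assert (Cc : forall c : R, continuous (fun _ : R => c) 0)
      by (intros c; apply continuous_const).
    unfold L3; simpl; apply Cm.
    - repeat first [apply Cs | apply Cm | apply Cc]; assumption.
    - apply continuous_Rinv_comp.
      + repeat first [apply Cs | apply Cm | apply Cc]; assumption.
      + assert (0 < u0 0 * (u0 0 * (u0 0 * 1))); [|lra].
        repeat apply Rmult_lt_0_compat; lra. }
  (* A deviation below [u0 0] keeps [u0] positive; a deviation below 1 bounds [L3] by |L3(0)| +
     1. *)
  destruct (continuous_neighborhood_0 u0 (u0 0) C0 Hpos) as [d1 [Hd1 B1]].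
  destruct (continuous_neighborhood_0 L3 1 CL Rlt_0_1) as [d2 [Hd2 B2]].
  assert (P : forall t, Rabs t < Rmin d1 d2 -> 0 < u0 t).
  { intros t Ht; specialize (B1 t (Rlt_le_trans _ _ _ Ht (Rmin_l _ _))).
    apply Rabs_def2 in B1; lra. }
  exists L3, (Rmin d1 d2), (Rabs (L3 0) + 1).
  split; [|exact P]; split; [apply Rmin_glb_lt; assumption|].
  split; [pose proof (Rabs_pos (L3 0)); lra|]; intros t H.
  split; [|split; [|split]].
  - specialize (P t H); auto_derive.
    + repeat split; [exists (u1 t); apply H0|exact P].
    + change (fun x => u0 x) with u0; rewrite (is_derive_unique _ _ _ (H0 t)); field; lra.
  - specialize (P t H); auto_derive.
    + repeat split; [exists (u2 t); apply H1|exists (u1 t); apply H0|lra].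
    + change (fun x => u0 x) with u0; change (fun x => u1 x) with u1.
      rewrite (is_derive_unique _ _ _ (H0 t)), (is_derive_unique _ _ _ (H1 t)); field; lra.
  - specialize (P t H); auto_derive.
    + repeat split; [exists (u3 t); apply H2|exists (u1 t); apply H0|
                     exists (u2 t); apply H1|exists (u1 t); apply H0|].
      assert (0 < u0 t * (u0 t * 1)); [|lra]. repeat apply Rmult_lt_0_compat; lra.
    + change (fun x => u0 x) with u0; change (fun x => u1 x) with u1;
        change (fun x => u2 x) with u2.
      rewrite (is_derive_unique _ _ _ (H0 t)), (is_derive_unique _ _ _ (H1 t)),
        (is_derive_unique _ _ _ (H2 t)); unfold L3; field; lra.
  - specialize (B2 t (Rlt_le_trans _ _ _ H (Rmin_r _ _))).
    replace (L3 t) with ((L3 t - L3 0) + L3 0) by ring.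
    eapply Rle_trans; [apply Rabs_triang|]; lra.
Qed.

(** The bound on [L3] is integrated three times from 0 by [antiderivative_bound]. *)
Lemma log_jet_taylor (L L1 L2 L3 : R -> R) (d M : R) :
  log_jet L L1 L2 L3 d M ->
  forall t, 0 <= t < d ->
    Rabs (L2 t - L2 0) <= M * t /\
    Rabs (L1 t - (L1 0 + L2 0 * t)) <= M * t ^ 2 /\
    Rabs (L t - (L 0 + L1 0 * t + L2 0 * t ^ 2 / 2)) <= M * t ^ 3.
Proof.
  intros [Hd [HM H]].
  assert (D : forall s, 0 <= s < d -> Rabs s < d)
    by (intros s Hs; rewrite Rabs_pos_eq; lra).
  assert (B2 : forall s, 0 <= s < d -> Rabs (L2 s - L2 0) <= M * s ^ 1).
  { apply (antiderivative_bound (fun s => L2 s - L2 0) L3); auto; [|lra|].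
    - intros s Hs; destruct (H s (D s Hs)) as (_ & _ & E & _).
      auto_derive; [eexists; exact E|].
      change (fun x => L2 x) with L2; rewrite (is_derive_unique _ _ _ E); ring.
    - intros s Hs; destruct (H s (D s Hs)) as (_ & _ & _ & E); simpl; lra. }
  assert (B1 : forall s, 0 <= s < d -> Rabs (L1 s - (L1 0 + L2 0 * s)) <= M * s ^ 2).
  { apply (antiderivative_bound (fun s => L1 s - (L1 0 + L2 0 * s))
             (fun s => L2 s - L2 0)); auto; [|ring].
    intros s Hs; destruct (H s (D s Hs)) as (_ & E & _ & _).
    auto_derive; [eexists; exact E|].
    change (fun x => L1 x) with L1; rewrite (is_derive_unique _ _ _ E); ring. }
  intros t Ht; split; [rewrite <- (pow_1 t) at 2; auto|split; auto].
  revert t Ht.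
  apply (antiderivative_bound (fun s => L s - (L 0 + L1 0 * s + L2 0 * s ^ 2 / 2))
           (fun s => L1 s - (L1 0 + L2 0 * s))); auto; [|field].
  intros s Hs; destruct (H s (D s Hs)) as (E & _ & _ & _).
  auto_derive; [eexists; exact E|].
  change (fun x => L x) with L; rewrite (is_derive_unique _ _ _ E); simpl; field.
Qed.

(** From f' / f = n / t + L1 follow rho = n + t L1 and rho' = L1 + t L2. Both summands of rho'
    contribute [L2 0 * t], whence the factor 2. *)
Lemma effective_order_expansion (n : nat) (f L L1 L2 L3 : R -> R) (d M : R) :
  log_jet L L1 L2 L3 d M ->
  (forall t, 0 < t < d -> f t = t ^ n * exp (L t)) ->
  (exists r, bigO_right0 3 r /\
     at_right 0 (fun t =>
       f t = t ^ n * exp (L 0) * exp (L1 0 * t + L2 0 * t ^ 2 / 2 + r t))) /\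
  at_right 0 (fun t => 0 < f t /\ ex_derive f t /\ ex_derive (effective_order f) t) /\
  bigO_right0 2 (fun t => Derive (effective_order f) t - (L1 0 + 2 * L2 0 * t)).
Proof.
  intros HL Hf.
  pose proof (log_jet_taylor _ _ _ _ _ _ HL) as T.
  destruct HL as [Hd [HM H]].
  assert (D : forall s, 0 < s < d -> Rabs s < d)
    by (intros s Hs; rewrite Rabs_pos_eq; lra).
  assert (loc : forall t, 0 < t < d -> locally t (fun s => 0 < s < d)).
  { intros t Ht.
    assert (He : 0 < Rmin t (d - t)) by (apply Rmin_glb_lt; lra).
    exists (mkposreal _ He); intros y Hy; change (Rabs (y - t) < Rmin t (d - t)) in Hy.
    pose proof (Rmin_l t (d - t)); pose proof (Rmin_r t (d - t)).
    apply Rabs_def2 in Hy; lra. }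
  assert (fpos : forall t, 0 < t < d -> 0 < f t).
  { intros t Ht; rewrite Hf by lra; apply Rmult_lt_0_compat;
      [apply pow_lt; lra|apply exp_pos]. }
  assert (Df : forall t, 0 < t < d -> is_derive f t (f t * (INR n / t + L1 t))).
  { intros t Ht; destruct (H t (D t Ht)) as (E & _).
    apply is_derive_ext_loc with (f := fun s => s ^ n * exp (L s)).
    - eapply filter_imp; [|apply (loc t Ht)]; intros s Hs; symmetry; apply Hf, Hs.
    - auto_derive; [eexists; exact E|].
      change (fun x => L x) with L; rewrite (is_derive_unique _ _ _ E), Hf by lra.
      (* The derivative of t^n contains t^(n-1) with a truncated exponent, so n = 0 is treated
         apart. *)
      destruct n as [|n]; [simpl; field; lra|].
      rewrite S_INR; simpl; field; lra. }
  assert (Erho : forall t, 0 < t < d -> effective_order f t = INR n + t * L1 t).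
  { intros t Ht; unfold effective_order; rewrite (is_derive_unique _ _ _ (Df t Ht)).
    specialize (fpos t Ht); field; lra. }
  assert (Drho : forall t, 0 < t < d -> is_derive (effective_order f) t (L1 t + t * L2 t)).
  { intros t Ht; destruct (H t (D t Ht)) as (_ & E & _).
    apply is_derive_ext_loc with (f := fun s => INR n + s * L1 s).
    - eapply filter_imp; [|apply (loc t Ht)]; intros s Hs; symmetry; apply Erho, Hs.
    - auto_derive; [eexists; exact E|].
      change (fun x => L1 x) with L1; rewrite (is_derive_unique _ _ _ E); ring. }
  split; [|split].
  - exists (fun t => L t - (L 0 + L1 0 * t + L2 0 * t ^ 2 / 2)); split.
    + exists M; apply (at_right_0 d); [exact Hd|]; intros t Ht; apply T; lra.
    + apply (at_right_0 d); [exact Hd|]; intros t Ht.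
      rewrite Hf, Rmult_assoc, <- exp_plus by lra; do 2 f_equal; ring.
  - apply (at_right_0 d); [exact Hd|]; intros t Ht; repeat split.
    + apply fpos, Ht.
    + eexists; apply Df, Ht.
    + eexists; apply Drho, Ht.
  (* One M t^2 comes from the remainder of [L1], the other from t times the remainder of [L2]. *)
  - exists (2 * M); apply (at_right_0 d); [exact Hd|]; intros t Ht.
    rewrite (is_derive_unique _ _ _ (Drho t Ht)).
    destruct (T t) as (T2 & T1 & _); [lra|].
    replace (L1 t + t * L2 t - (L1 0 + 2 * L2 0 * t))
      with ((L1 t - (L1 0 + L2 0 * t)) + t * (L2 t - L2 0)) by ring.
    eapply Rle_trans; [apply Rabs_triang|].
    rewrite Rabs_mult, (Rabs_pos_eq t) by lra.
    apply (Rmult_le_compat_l t) in T2; [|lra]; simpl in *; lra.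
Qed.

Lemma bigO_right0_affine (g : R -> R) (a b : R) :
  bigO_right0 2 (fun t => g t - (a + b * t)) ->
  filterlim g (at_right 0) (locally a) /\
  (a < 0 \/ (a = 0 /\ b < 0) -> at_right 0 (fun t => g t < 0)).
Proof.
  intros [M [d Hd]].
  (* The constant of [bigO_right0] may be negative, so it is replaced by its absolute value. *)
  assert (bound : forall t, 0 < t < d -> Rabs (g t - (a + b * t)) <= Rabs M * t ^ 2).
  { intros t Ht; eapply Rle_trans; [apply Hd; [|lra]|].
    - change (Rabs (t - 0) < d); rewrite Rminus_0_r, Rabs_pos_eq; lra.
    - apply Rmult_le_compat_r; [apply pow_le; lra|apply Rle_abs]. }
  pose proof (Rabs_pos M) as M0; pose proof (Rabs_pos b) as b0.
  pose proof (cond_pos d) as d0.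
  split.
  - intros A [e He].
    (* For t < 1 the deviation |g(t) - a| is at most (|M| + |b|) t. The added 1 keeps the
       denominator positive. *)
    apply (at_right_0 (Rmin d (Rmin 1 (e / (Rabs M + Rabs b + 1))))).
    + repeat apply Rmin_glb_lt; try lra.
      apply Rdiv_lt_0_compat; [apply cond_pos|lra].
    + intros t Ht; apply He; change (Rabs (g t - a) < e).
      pose proof (Rmin_l d (Rmin 1 (e / (Rabs M + Rabs b + 1)))) as I1.
      pose proof (Rmin_r d (Rmin 1 (e / (Rabs M + Rabs b + 1)))) as I2.
      pose proof (Rmin_l 1 (e / (Rabs M + Rabs b + 1))) as I3.
      pose proof (Rmin_r 1 (e / (Rabs M + Rabs b + 1))) as I4.
      assert (H : t * (Rabs M + Rabs b + 1) < e).
      { apply Rmult_lt_reg_r with (/ (Rabs M + Rabs b + 1));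
          [apply Rinv_0_lt_compat; lra|].
        rewrite Rmult_assoc, Rinv_r by lra; unfold Rdiv in I4; lra. }
      replace (g t - a) with ((g t - (a + b * t)) + b * t) by ring.
      eapply Rle_lt_trans; [apply Rabs_triang|].
      rewrite Rabs_mult, (Rabs_pos_eq t) by lra.
      assert (Hb := bound t ltac:(lra)).
      assert (Rabs M * t ^ 2 <= Rabs M * t) by (apply Rmult_le_compat_l; nra).
      nra.
  - intros Hneg.
    assert (Hs : exists s, 0 < s /\ forall t, 0 < t < s -> a + b * t + Rabs M * t ^ 2 < 0).
    { destruct Hneg as [Ha|[-> Hb]].
      (* The same estimate, with -a in place of e. *)
      - exists (Rmin 1 (- a / (Rabs M + Rabs b + 1))); split.
        + apply Rmin_glb_lt; [lra|apply Rdiv_lt_0_compat; lra].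
        + intros t Ht.
          pose proof (Rmin_l 1 (- a / (Rabs M + Rabs b + 1))) as I3.
          pose proof (Rmin_r 1 (- a / (Rabs M + Rabs b + 1))) as I4.
          assert (H : t * (Rabs M + Rabs b + 1) < - a).
          { apply Rmult_lt_reg_r with (/ (Rabs M + Rabs b + 1));
              [apply Rinv_0_lt_compat; lra|].
            rewrite Rmult_assoc, Rinv_r by lra; unfold Rdiv in I4; lra. }
          pose proof (Rle_abs b).
          assert (Rabs M * t ^ 2 <= Rabs M * t) by (apply Rmult_le_compat_l; nra).
          nra.
      (* After division by t, the claim is b + |M| t < 0. *)
      - exists (- b / (Rabs M + 1)); split; [apply Rdiv_lt_0_compat; lra|].
        intros t Ht.
        assert (H : t * (Rabs M + 1) < - b).
        { apply Rmult_lt_reg_r with (/ (Rabs M + 1)); [apply Rinv_0_lt_compat; lra|].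
          rewrite Rmult_assoc, Rinv_r by lra; unfold Rdiv in Ht; lra. }
        nra. }
    destruct Hs as [s [s0 Hs]].
    apply (at_right_0 (Rmin d s)); [apply Rmin_glb_lt; lra|]; intros t Ht.
    pose proof (Rmin_l d s); pose proof (Rmin_r d s).
    assert (Hb := bound t ltac:(lra)); specialize (Hs t ltac:(lra)).
    apply Rabs_le_between in Hb; lra.
Qed.

(** * Logarithm of the modulus of the divided difference *)

Lemma is_derive_PSeries_iter (a : nat -> R) (n : nat) (t : R) :
  CV_radius a = p_infty ->
  is_derive (PSeries (Nat.iter n PS_derive a)) t (PSeries (Nat.iter (S n) PS_derive a) t).
Proof.
  intros H; apply is_derive_PSeries.
  replace (CV_radius (Nat.iter n PS_derive a)) with p_infty; [exact I|].
  induction n as [|n IH]; [symmetry; exact H|].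
  simpl; rewrite CV_radius_derive; exact IH.
Qed.

(** Here P 0 and Q 0 are the real and imaginary parts of a function and k counts derivatives, so
    [u0] is the squared modulus and [u1], [u2] are its derivatives. *)
Lemma sum_squares_log_jet (P Q : nat -> R -> R) :
  (forall k t, is_derive (P k) t (P (S k) t)) ->
  (forall k t, is_derive (Q k) t (Q (S k) t)) ->
  let u0 := fun t => P 0%nat t ^ 2 + Q 0%nat t ^ 2 in
  let u1 := fun t => 2 * (P 0%nat t * P 1%nat t + Q 0%nat t * Q 1%nat t) in
  let u2 := fun t => 2 * (P 0%nat t * P 2%nat t + P 1%nat t ^ 2
                          + Q 0%nat t * Q 2%nat t + Q 1%nat t ^ 2) in
  0 < u0 0 ->
  exists L3 d M,
    log_jet (fun t => ln (u0 t) / 2) (fun t => u1 t / (2 * u0 t))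
      (fun t => (u2 t * u0 t - u1 t ^ 2) / (2 * u0 t ^ 2)) L3 d M /\
    forall t, Rabs t < d -> 0 < u0 t.
Proof.
  intros DP DQ u0 u1 u2.
  assert (EP : forall k t, ex_derive (P k) t) by (intros k t; eexists; apply DP).
  assert (EQ : forall k t, ex_derive (Q k) t) by (intros k t; eexists; apply DQ).
  assert (VP : forall k t, Derive (fun x => P k x) t = P (S k) t)
    by (intros k t; apply is_derive_unique, DP).
  assert (VQ : forall k t, Derive (fun x => Q k x) t = Q (S k) t)
    by (intros k t; apply is_derive_unique, DQ).
  set (u3 := fun t => 2 * (P 0%nat t * P 3%nat t + 3 * P 1%nat t * P 2%nat t
                           + Q 0%nat t * Q 3%nat t + 3 * Q 1%nat t * Q 2%nat t)).
  apply log_jet_of_jet with (u3 := u3).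
  - intros t; unfold u0, u1; auto_derive; [repeat split; auto|rewrite ?VP, ?VQ; ring].
  - intros t; unfold u1, u2; auto_derive; [repeat split; auto|rewrite ?VP, ?VQ; ring].
  - intros t; unfold u2, u3; auto_derive; [repeat split; auto|rewrite ?VP, ?VQ; ring].
  - apply (ex_derive_continuous (V := R_NormedModule)).
    unfold u3; auto_derive; repeat split; auto.
Qed.

(** At 0 one has P = 1 / n! and Q = 0, so the formulas for the derivatives reduce to L1 = P' / P and
    L2 = (P P'' + Q'^2 - P'^2) / P^2. Inserting h_1 and h_2 in power sums, the two terms with
    Re(S1^2) combine through 1 / ((n+1)(n+2)) - 1 / (n+1)^2 = -1 / ((n+1)^2 (n+2)). *)
Lemma divdiff_exp_log_jet (x : C) (s : list C) :
  let n := length s in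
  let S1 := Csum (x :: s) in
  let S2 := Csum (map (fun z => z * z)%C (x :: s)) in
  exists L L1 L2 L3 d M,
    log_jet L L1 L2 L3 d M /\
    (forall t, 0 < t < d ->
       Cmod (divdiff (exp_t t) (x :: s)) = t ^ n * exp (L t)) /\
    exp (L 0) = / INR (fact n) /\
    L1 0 = fst S1 / (INR n + 1) /\
    L2 0 = (fst S2 / (INR n + 1) - fst (S1 * S1)%C / (INR n + 1) ^ 2) / (INR n + 2).
Proof.
  intros n S1 S2.
  set (a := fun j => fst (hsym (x :: s) j) / INR (fact (j + n))).
  set (b := fun j => snd (hsym (x :: s) j) / INR (fact (j + n))).
  (* Dividing by t^n requires t > 0; convergence there already makes both radii infinite, so P and Q
     are smooth around 0. *)
  assert (HS : forall t, 0 < t ->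
     is_series (fun j => a j * t ^ j) (fst (divdiff (exp_t t) (x :: s)) / t ^ n) /\
     is_series (fun j => b j * t ^ j) (snd (divdiff (exp_t t) (x :: s)) / t ^ n)).
  { intros t Ht; assert (Htn : t ^ n <> 0) by (apply pow_nonzero; lra).
    destruct (divdiff_exp_series t n x s eq_refl) as [Ha Hb].
    split.
    - apply is_series_ext with (2 := is_series_scal_r (/ t ^ n) _ _ Ha); intros j.
      unfold a; rewrite Rdef_pow_add; simpl; field; split; [apply INR_fact_neq_0|exact Htn].
    - apply is_series_ext with (2 := is_series_scal_r (/ t ^ n) _ _ Hb); intros j.
      unfold b; rewrite Rdef_pow_add; simpl; field; split; [apply INR_fact_neq_0|exact Htn]. }
  assert (Ra : CV_radius a = p_infty)
    by (apply CV_radius_infinite; intros t Ht; eexists; apply (HS t Ht)).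
  assert (Rb : CV_radius b = p_infty)
    by (apply CV_radius_infinite; intros t Ht; eexists; apply (HS t Ht)).
  set (P := fun k => PSeries (Nat.iter k PS_derive a)).
  set (Q := fun k => PSeries (Nat.iter k PS_derive b)).
  assert (DP : forall k t, is_derive (P k) t (P (S k) t))
    by (intros k t; apply is_derive_PSeries_iter, Ra).
  assert (DQ : forall k t, is_derive (Q k) t (Q (S k) t))
    by (intros k t; apply is_derive_PSeries_iter, Rb).
  assert (N : forall k, INR (fact k) <> 0) by apply INR_fact_neq_0.
  assert (P0 : P 0%nat 0 = / INR (fact n)).
  { unfold P; rewrite PSeries_0; simpl Nat.iter; unfold a; rewrite hsym_0; simpl; field; auto. }
  assert (Q0 : Q 0%nat 0 = 0).
  { unfold Q; rewrite PSeries_0; simpl Nat.iter; unfold b; rewrite hsym_0; simpl; field; auto. }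
  assert (n0 : 0 <= INR n) by apply pos_INR.
  assert (Fn1 : INR (fact (1 + n)) = (INR n + 1) * INR (fact n))
    by (rewrite fact_simpl, mult_INR, S_INR; reflexivity).
  assert (Fn2 : INR (fact (2 + n)) = (INR n + 2) * (INR n + 1) * INR (fact n)).
  { change (2 + n)%nat with (S (1 + n)); rewrite fact_simpl, mult_INR, Fn1.
    simpl (1 + n)%nat; rewrite !S_INR; ring. }
  assert (P1 : P 1%nat 0 = fst S1 / ((INR n + 1) * INR (fact n))).
  { unfold P; rewrite PSeries_0; simpl Nat.iter; unfold PS_derive, a.
    rewrite hsym_1, Fn1; fold S1; simpl INR; field; split; [auto|lra]. }
  assert (Q1 : Q 1%nat 0 = snd S1 / ((INR n + 1) * INR (fact n))).
  { unfold Q; rewrite PSeries_0; simpl Nat.iter; unfold PS_derive, b.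
    rewrite hsym_1, Fn1; fold S1; simpl INR; field; split; [auto|lra]. }
  (* The second derivative at 0 is twice the coefficient of t^2, and 2 h_2 is given by [hsym_2]. *)
  assert (P2 : P 2%nat 0 = (fst (S1 * S1)%C + fst S2)
                         / ((INR n + 2) * (INR n + 1) * INR (fact n))).
  { unfold P; rewrite PSeries_0; simpl Nat.iter; unfold PS_derive, a.
    assert (H2 := f_equal fst (hsym_2 (x :: s))); fold S1 S2 in H2.
    rewrite Fn2; simpl INR.
    replace (fst (S1 * S1)%C + fst S2) with (2 * fst (hsym (x :: s) 2)).
    - field; repeat split; [auto|lra|lra].
    - transitivity (fst (RtoC 2 * hsym (x :: s) 2)%C); [cbn [fst snd RtoC Cmult]; ring|].
      rewrite H2; reflexivity. }
  assert (U0 : P 0%nat 0 ^ 2 + Q 0%nat 0 ^ 2 = / INR (fact n) ^ 2)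
    by (rewrite P0, Q0; field; auto).
  assert (Upos : 0 < P 0%nat 0 ^ 2 + Q 0%nat 0 ^ 2).
  { rewrite U0; apply Rinv_0_lt_compat, pow_lt, INR_fact_lt_0. }
  destruct (sum_squares_log_jet P Q DP DQ Upos) as [L3 [d [M [HL Hd]]]].
  do 6 eexists; split; [exact HL|].
  assert (sqrt_exp : forall u, 0 < u -> exp (ln u / 2) = sqrt u).
  { intros u Hu; rewrite <- Rpower_sqrt by exact Hu; unfold Rpower; f_equal; field. }
  split; [|split; [|split]]; cbv beta.
  - intros t Ht.
    assert (Hpow : 0 < t ^ n) by (apply pow_lt; lra).
    rewrite sqrt_exp by (apply Hd; rewrite Rabs_pos_eq; lra).
    destruct (HS t (proj1 Ht)) as [Sa Sb].
    apply is_pseries_R, is_pseries_unique in Sa.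
    apply is_pseries_R, is_pseries_unique in Sb.
    (* The modulus is sqrt((t^n)^2 (P^2 + Q^2)), and t^n > 0 leaves the root unchanged. *)
    unfold Cmod, P, Q; simpl Nat.iter; rewrite Sa, Sb.
    rewrite <- (sqrt_pow2 (t ^ n)) at 1 by lra.
    rewrite <- sqrt_mult_alt by (apply pow2_ge_0); f_equal; field; lra.
  - rewrite sqrt_exp, U0, <- pow_inv, sqrt_pow2 by
      first [exact Upos | left; apply Rinv_0_lt_compat, INR_fact_lt_0]; reflexivity.
  - rewrite P0, Q0, P1, Q1; field; repeat split; first [lra | auto].
  - rewrite P0, Q0, P1, Q1, P2; cbn [fst snd Cmult].
    field; repeat split; first [lra | auto].
Qed.

(** * Sums over the nodes *)

Lemma sum_n_m_fold (m : nat) (a : nat -> R) :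
  sum_n_m a 1 m = fold_right Rplus 0 (map a (seq 1 m)).
Proof.
  induction m as [|m IH]; [exact (sum_n_m_zero a 1 0 Nat.lt_0_1)|].
  rewrite sum_n_Sm by lia; rewrite seq_S, map_app, fold_right_app, IH; simpl.
  unfold plus; simpl; rewrite Rplus_0_r.
  (* The last term has become the initial value of the right fold; it is moved outside for an
     arbitrary value c. *)
  clear IH; generalize (a (S m)) as c; induction (seq 1 m) as [|i l IHl]; intros c; simpl; [ring|].
  rewrite Rplus_assoc, IHl; reflexivity.
Qed.

Lemma fst_Csum (l : list C) : fst (Csum l) = fold_right Rplus 0 (map fst l).
Proof. induction l as [|z l IH]; simpl; [|rewrite <- IH]; reflexivity. Qed.

Lemma snd_Csum (l : list C) : snd (Csum l) = fold_right Rplus 0 (map snd l).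
Proof. induction l as [|z l IH]; simpl; [|rewrite <- IH]; reflexivity. Qed.

Lemma seq_var_alt (m : nat) (a : nat -> R) :
  (0 < m)%nat ->
  seq_var m a = sum_n_m (fun j => a j ^ 2) 1 m / INR m - (sum_n_m a 1 m / INR m) ^ 2.
Proof.
  intros Hm; unfold seq_var.
  (* The centre c is kept free of the number of terms, since the average itself changes with it;
     this makes induction possible. *)
  assert (E : forall c k, sum_n_m (fun j => (a j - c) ^ 2) 1 k
     = sum_n_m (fun j => a j ^ 2) 1 k - 2 * c * sum_n_m a 1 k + INR k * c ^ 2).
  { intros c k; induction k as [|k IH].
    - rewrite !sum_n_m_zero by lia; unfold zero; simpl; ring.
    - rewrite !sum_n_Sm, IH, S_INR by lia; unfold plus; simpl; ring. }
  rewrite E; unfold seq_avg; field; apply not_0_INR; lia.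
Qed.

Lemma sum_n_m_nonneg (m : nat) (a : nat -> R) :
  (forall j, (1 <= j <= m)%nat -> 0 <= a j) -> 0 <= sum_n_m a 1 m.
Proof.
  induction m as [|m IH]; intros H.
  - rewrite sum_n_m_zero by lia; apply Rle_refl.
  - rewrite sum_n_Sm by lia; apply Rplus_le_le_0_compat; [apply IH; intros; apply H|apply H]; lia.
Qed.

Lemma sum_n_m_pos (m : nat) (a : nat -> R) (i : nat) :
  (forall j, (1 <= j <= m)%nat -> 0 <= a j) ->
  (1 <= i <= m)%nat -> 0 < a i -> 0 < sum_n_m a 1 m.
Proof.
  induction m as [|m IH]; intros H Hi Hpos; [lia|].
  assert (H' : forall j, (1 <= j <= m)%nat -> 0 <= a j) by (intros; apply H; lia).
  rewrite sum_n_Sm by lia; unfold plus; simpl.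
  destruct (Nat.eq_dec i (S m)) as [->|Hne].
  - pose proof (sum_n_m_nonneg m a H'); lra.
  - assert (0 < sum_n_m a 1 m) by (apply IH; auto; lia).
    pose proof (H (S m) ltac:(lia)); lra.
Qed.

Lemma seq_avg_nonpos (m : nat) (a : nat -> R) :
  (0 < m)%nat -> (forall j, (1 <= j <= m)%nat -> a j <= 0) ->
  (forall j, (1 <= j <= m)%nat -> a j = 0) \/ seq_avg m a < 0.
Proof.
  intros Hm H.
  destruct (classic (exists i, (1 <= i <= m)%nat /\ a i <> 0)) as [[i [Hi Hne]]|Hno].
  - right.
    assert (P : 0 < sum_n_m (fun j => - a j) 1 m).
    { apply sum_n_m_pos with i; auto.
      - intros j Hj; pose proof (H j Hj); lra.
      - pose proof (H i Hi); lra. }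
    assert (E : forall k, sum_n_m (fun j => - a j) 1 k = - sum_n_m a 1 k).
    { induction k as [|k IH]; [rewrite !sum_n_m_zero by lia; unfold zero; simpl; ring|].
      rewrite !sum_n_Sm, IH by lia; unfold plus; simpl; ring. }
    rewrite E in P; unfold seq_avg, Rdiv.
    assert (0 < / INR m) by (apply Rinv_0_lt_compat, lt_0_INR; lia); nra.
  - left; intros j Hj; apply NNPP; intros Hne; apply Hno; eauto.
Qed.

(** A sequence that equals its average everywhere is constant, so some squared deviation is
    positive. *)
Lemma seq_var_pos (m : nat) (a : nat -> R) : ~ constant_seq m a -> 0 < seq_var m a.
Proof.
  intros Hnc.
  destruct (classic
              (exists i, (1 <= i <= m)%nat /\ a i <> seq_avg m a)) as [[i [Hi Hne]]|Hno].
  - apply Rdiv_lt_0_compat; [|apply lt_0_INR; lia].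
    apply sum_n_m_pos with i; auto.
    + intros j _; apply pow2_ge_0.
    + apply pow2_gt_0; lra.
  - exfalso; apply Hnc; intros i j Hi Hj.
    transitivity (seq_avg m a); [|symmetry]; apply NNPP; intros Hne;
      apply Hno; eauto.
Qed.

Lemma seq_var_zero (m : nat) (a : nat -> R) :
  (0 < m)%nat -> (forall j, (1 <= j <= m)%nat -> a j = 0) ->
  seq_avg m a = 0 /\ seq_var m a = 0.
Proof.
  intros Hm H.
  assert (E : forall b : nat -> R, (forall j, (1 <= j <= m)%nat -> b j = 0) -> sum_n_m b 1 m = 0).
  { intros b Hb; rewrite (sum_n_m_ext_loc b (fun _ => 0)) by exact Hb.
    rewrite sum_n_m_const; apply Rmult_0_r. }
  assert (A : seq_avg m a = 0) by (unfold seq_avg; rewrite E by exact H; unfold Rdiv; ring).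
  split; [exact A|].
  unfold seq_var; rewrite A, E; [unfold Rdiv; ring|].
  intros j Hj; rewrite H by exact Hj; ring.
Qed.

Theorem theorem5 (m : nat) (xi eta : nat -> R)
    (Hnonconst : ~ constant_seq m xi \/ ~ constant_seq m eta)
    (Hxi : forall j : nat, (1 <= j <= m)%nat -> xi j <= 0) :
  let f : R -> R := fun t => Cmod (divdiff (exp_t t) (nodes m xi eta)) in
  let rho : R -> R := effective_order f in
  let rho1 : R := seq_avg m xi in
  let rho2 : R := (seq_var m xi - seq_var m eta) / (INR m + 1) in
  (* (a) *)
  ((exists r : R -> R,
      bigO_right0 3 r /\
      at_right 0 (fun t =>
        f t = t ^ (m - 1) / INR (fact (m - 1))
              * exp (rho1 * t + rho2 * t ^ 2 / 2 + r t))) /\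
   (rho1 <> 0 \/ rho2 <> 0)) /\
  (* (b): by (a), rho t = t (ln f)' = (m - 1) + rho1 t + rho2 t^2 + ..., whence
     the coefficient 2 rho2.  The limit of rho' at 0+ is rho1, which vanishes
     when all xi_j are 0, so its negativity is claimed as negativity of rho'
     near 0+ and, if some xi_j is nonzero, of the limit itself. *)
  (at_right 0 (fun t => 0 < f t /\ ex_derive f t /\ ex_derive rho t) /\
   bigO_right0 2 (fun t => Derive rho t - (rho1 + 2 * rho2 * t)) /\
   at_right 0 (fun t => Derive rho t < 0) /\
   (exists l : R,
      filterlim (Derive rho) (at_right 0) (locally l) /\
      l <= 0 /\
      ((exists j : nat, (1 <= j <= m)%nat /\ xi j <> 0) -> l < 0))).
Proof.
  intros f rho rho1 rho2.
  (* Over an empty range of indices every sequence is constant. *)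
  assert (Hm : (0 < m)%nat).
  { destruct m; [|lia]; exfalso; destruct Hnonconst as [H|H]; apply H; intros i j; lia. }
  assert (m0 : 0 < INR m) by (apply lt_0_INR; exact Hm).
  (* This dichotomy gives both the last claim of (a) and the negativity in (b). If [rho1] is 0, all
     [xi j] vanish, so [eta] is the nonconstant sequence. *)
  assert (sign : rho1 < 0 \/ (rho1 = 0 /\ rho2 < 0)).
  { destruct (seq_avg_nonpos m xi Hm Hxi) as [Hz|Hneg]; [right|left; exact Hneg].
    destruct (seq_var_zero m xi Hm Hz) as [A V]; split; [exact A|].
    unfold rho2; rewrite V.
    destruct Hnonconst as [H|H].
    - exfalso; apply H; intros i j Hi Hj; rewrite !Hz by assumption; reflexivity.
    - apply seq_var_pos in H; unfold Rdiv.
      assert (0 < / (INR m + 1)) by (apply Rinv_0_lt_compat; lra); nra. }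
  assert (nonzero : (exists j, (1 <= j <= m)%nat /\ xi j <> 0) -> rho1 < 0).
  { intros [j [Hj Hne]].
    destruct (seq_avg_nonpos m xi Hm Hxi) as [Hz|Hneg]; [|exact Hneg].
    exfalso; apply Hne, Hz, Hj. }
  assert (S1 : fst (Csum (nodes m xi eta)) = sum_n_m xi 1 m).
  { rewrite fst_Csum, sum_n_m_fold; unfold nodes; rewrite map_map; reflexivity. }
  assert (S1' : snd (Csum (nodes m xi eta)) = sum_n_m eta 1 m).
  { rewrite snd_Csum, sum_n_m_fold; unfold nodes; rewrite map_map; reflexivity. }
  assert (S2 : fst (Csum (map (fun z => z * z)%C (nodes m xi eta)))
               = sum_n_m (fun j => xi j ^ 2) 1 m - sum_n_m (fun j => eta j ^ 2) 1 m).
  { rewrite fst_Csum, !sum_n_m_fold; unfold nodes; rewrite !map_map.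
    induction (seq 1 m) as [|i l IH]; simpl in *; [ring|rewrite IH; ring]. }
  assert (Hlen : length (nodes m xi eta) = m)
    by (unfold nodes; rewrite length_map, length_seq; reflexivity).
  unfold f in *; clear f.
  destruct (nodes m xi eta) as [|x s]; [simpl in Hlen; lia|].
  simpl in Hlen.
  destruct (divdiff_exp_log_jet x s) as (L & L1 & L2 & L3 & d & M & HL & Hf & E0 & E1 & E2).
  replace (INR (length s) + 1) with (INR m) in E1, E2 by (rewrite <- Hlen, S_INR; ring).
  replace (INR (length s) + 2) with (INR m + 1) in E2 by (rewrite <- Hlen, S_INR; ring).
  assert (R1 : L1 0 = rho1) by (rewrite E1, S1; reflexivity).
  assert (R2 : L2 0 = rho2).
  { rewrite E2; unfold rho2; rewrite !seq_var_alt by exact Hm.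
    rewrite S2; cbn [fst snd Cmult]; rewrite S1, S1'; field; lra. }
  destruct (effective_order_expansion _ _ _ _ _ _ _ _ HL Hf) as [Ha [Hreg HO]].
  rewrite R1, R2 in Ha, HO; rewrite E0 in Ha.
  replace (m - 1)%nat with (length s) by lia.
  destruct (bigO_right0_affine _ _ _ HO) as [Hlim Hneg].
  split; [split|split; [|split; [|split]]].
  - exact Ha.
  - lra.
  - exact Hreg.
  - exact HO.
  - apply Hneg; lra.
  - exists rho1; split; [exact Hlim|split; [lra|exact nonzero]].
Qed.
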